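(* In the setting fixed in the context (spaces $\mathcal H,\mathcal K$, function $h$, sequences $(x_n),(z_n),(\alpha_n),(\beta_n),(\Delta_n),(\varepsilon_n)$, index set $I$ and weights $\lambda_i$), suppose that (H1), (H2), (H3) and (H4) hold and that the sequence $(z_n)_{n\in\mathbb N}$ is bounded. Let $\Omega$ be the set of cluster points of $(z_n)_{n\in\mathbb N}$ and suppose that $h$ is constant on $\Omega$ and satisfies the KL property at each point of $\Omega$. Set $\Omega_0:=\{\overline z\in\Omega: h(z_n)\to h(\overline z)\text{ as }n\to+\infty\}$ and $\overline h:=h(z)$ for $z\in\Omega_0$. Then the following hold: (i) $\sum_{n=0}^{+\infty}\Delta_n<+\infty$. (ii) If (H5) holds, then $\sum_{n=0}^{+\infty}\|x_{n+1}-x_n\|<+\infty$, and the sequence $(x_n)_{n\in\mathbb N}$ is convergent. (iii) If $\inf_{n\in\mathbb N}\beta_n>0$, then, for all $\overline z\in\Omega_0$, $0\in\partial_Lh(\overline z)$. (iv) Suppose further that $h$ satisfies the KL property at every point of $\Omega$ with an exponent of $\alpha\le1/2$, that $\underline\imath\le1$, and that $$\delta:=\inf_{n\in\mathbb N,\,i\in I}\alpha_{n-i}\beta_n^2>0\quad\text{and}\quad \frac{\varepsilon_n}{\beta_n}=O\left(\sqrt{h(z_{n-\overline\imath})-h(z_{n+1-\underline\imath})}\right)\text{ as }n\to+\infty.$$ Then there exist $\gamma_1\in\mathbb R_{++}$ and $\rho\in(0,1)$ such that, for all $n\in\mathbb N$, $h(z_n)-\overline h\le\gamma_1\rho^n$.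 Moreover, if additionally (H5) holds and $\sum_{k=n}^{+\infty}\varepsilon_k=O\left(\sqrt{h(z_{n-\overline\imath})-\overline h}\right)$ as $n\to+\infty$, then there exist $\overline x\in\mathcal H$ and $\gamma_2\in\mathbb R_{++}$ such that, for all $n\in\mathbb N$, $\|x_n-\overline x\|\le\gamma_2\rho^{\frac n2}$.
   Context: $\mathbb N=\{0,1,2,\dots\}$, $\mathbb R_+=[0,+\infty)$, $\mathbb R_{++}=(0,+\infty)$. $\mathcal H,\mathcal K$ are finite-dimensional real Hilbert spaces; $h\colon\mathcal K\to(-\infty,+\infty]$ is proper lower semicontinuous; $(x_n)_{n\in\mathbb N}$ and $(z_n)_{n\in\mathbb N}$ are sequences in $\mathcal H$ and $\mathcal K$ respectively; $(\alpha_n)_{n\in\mathbb N},(\beta_n)_{n\in\mathbb N}$ are sequences in $\mathbb R_{++}$; $(\Delta_n)_{n\in\mathbb N},(\varepsilon_n)_{n\in\mathbb N}$ are sequences in $\mathbb R_+$; $\underline\imath\le\overline\imath$ are two (not necessarily positive) integers, $I:=\{\underline\imath,\underline\imath+1,\dots,\overline\imath\}$, and $\lambda_i\in\mathbb R_+$ ($i\in I$) satisfy $\sum_{i\in I}\lambda_i=1$. Set $\Delta_k=0$ for $k<0$. Infima of $\alpha_{n-i}\beta_n^2$ over $n\in\mathbb N$, $i\in I$ are over pairs with $n-i\ge0$. Conditions: (H1) For each $n\in\mathbb N$, $h(z_{n+1})+\alpha_n\Delta_n^2\le h(z_n)$. (H2) For each $n\in\mathbb N$, $\beta_n\operatorname{dist}(0,\partial_Lh(z_n))\le\sum_{i\in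 I}\lambda_i\Delta_{n-i}+\varepsilon_n$. (H3) There exist a subsequence $(z_{k_n})_{n\in\mathbb N}$ and $\widetilde z$ such that $z_{k_n}\to\widetilde z$ and $h(z_{k_n})\to h(\widetilde z)$ as $n\to+\infty$. (H4) $\underline\alpha:=\inf_{n}\alpha_n>0$, $\underline\gamma:=\inf_n\alpha_n\beta_n>0$, and $\sum_{n=1}^{+\infty}\varepsilon_n<+\infty$. (H5) There exist $j\in\mathbb Z$ and $c\in\mathbb R$ such that, for all $n\in\mathbb N$, $\|x_{n+1}-x_n\|\le c\Delta_{n+j}$. Subdifferentials: for $h$ finite at $x$, the Fréchet subdifferential is $\widehat\partial h(x)=\{u:\liminf_{z\to x}\frac{h(z)-h(x)-\langle u,z-x\rangle}{\|z-x\|}\ge0\}$, and the limiting subdifferential $\partial_Lh(x)$ is the set of all $u$ for which there exist $y_n\to x$ with $h(y_n)\to h(x)$ and $u_n\in\widehat\partial h(y_n)$ with $u_n\to u$; both are $\varnothing$ where $h$ is not finite. $\operatorname{dom}\partial_Lh=\{x:\partial_Lh(x)\ne\varnothing\}$. $\operatorname{dist}(0,\varnothing)=+\infty$. KL property: for $\eta\in(0,+\infty]$, $\Phi_\eta$ is the class of continuous concave functions $\varphi\colon[0,\eta)\to\mathbb R_+$ with $\varphi(0)=0$, continuously differentiable on $(0,\eta)$ with $\varphi'>0$. $h$ satisfies the KL property at $\overline x\in\operatorname{dom}\partial_Lh$ if there exist a neighborhood $U$ of $\overline x$, $\eta\in(0,+\infty]$ and $\varphi\in\Phi_\eta$ such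 that $\varphi'(h(x)-h(\overline x))\operatorname{dist}(0,\partial_Lh(x))\ge1$ for all $x\in U$ with $h(\overline x)<h(x)<h(\overline x)+\eta$. If $\varphi$ can be chosen as $\varphi(s)=\gamma s^{1-\alpha}$ for some $\gamma\in\mathbb R_{++}$ and $\alpha\in[0,1)$, then $h$ has the KL property at $\overline x$ with an exponent of $\alpha$. *)

(* Defs.v *)
From HB Require Import structures.
From mathcomp Require Import all_boot all_order all_algebra.
From mathcomp Require Import zify.
From mathcomp Require Import all_classical all_reals all_analysis.

Set Implicit Arguments.
Unset Strict Implicit.
Unset Printing Implicit Defensive.

Import Order.TTheory GRing.Theory Num.Theory.
Import numFieldNormedType.Exports.

Local Open Scope classical_set_scope.
Local Open Scope ring_scope.

(* The norm (and hence the topology) is the one induced by the inner product.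
   Completeness is not required separately: it follows from finite dimension. *)
HB.mixin Record NormedModule_isEuclidean (R : realType) V
    & NormedModule R V := {
  inner : {dot V for (@idfun R)};
  norm_inner : forall x : V, `|x| ^+ 2 = inner x x
}.

#[short(type="finHilbertType")]
HB.structure Definition FinHilbert (R : realType) :=
  {V of NormedModule R V & Vector R V & NormedModule_isEuclidean R V}.

Section Subdifferentials.
Variables (R : realType) (K : finHilbertType R).
Implicit Types (h : K -> \bar R) (x u : K).
Local Open Scope ereal_scope.

Definition proper_function h := (forall x, -oo < h x) /\ (exists x, h x < +oo).

Definition frechet_subdiff h x : set K :=
  [set u | h x \is a fin_num /\
    0 <= limf_einf
      (fun z => (h z - h x - (inner u (z - x)%R)%:E) * (`|z - x|^-1)%:E) x^'].

Definition limiting_subdiff h x : set K :=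
  [set u | h x \is a fin_num /\
    exists y_ u_ : nat -> K,
      [/\ y_ n @[n --> \oo] --> x,
          h (y_ n) @[n --> \oo] --> h x,
          forall n, frechet_subdiff h (y_ n) (u_ n)
        & u_ n @[n --> \oo] --> u]].

(* Equal to +oo on the empty set, as ereal_inf set0 = +oo. *)
Definition dist0 (A : set K) : \bar R := ereal_inf [set `|u|%:E | u in A].

End Subdifferentials.

Section KurdykaLojasiewicz.
Variables (R : realType) (K : finHilbertType R).
Implicit Types (h : K -> \bar R) (xbar : K) (eta : \bar R) (phi : R -> R).

Definition half_open eta : set R := [set s | 0 <= s /\ (s%:E < eta)%E].
Definition open_itv eta : set R := [set s | 0 < s /\ (s%:E < eta)%E].

(* Functions on [0, eta) are restrictions of total functions R -> R, whose
   values outside [0, eta) are irrelevant. *)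
Definition desingularizing eta phi :=
  [/\ [/\ phi 0 = 0,
          forall s, half_open eta s -> 0 <= phi s,
          {within half_open eta, continuous phi} &
          convex_function (half_open eta : set R^o) (fun s => - phi s)],
      forall s, open_itv eta s -> derivable phi s 1,
      forall s, open_itv eta s -> {for s, continuous (derive1 phi)}
    & forall s, open_itv eta s -> 0 < derive1 phi s].

Definition KL_inequality h xbar eta phi (U : set K) :=
  forall x, U x -> (h xbar < h x)%E -> (h x < h xbar + eta)%E ->
    (1 <= (derive1 phi (fine (h x - h xbar)))%:E * dist0 (limiting_subdiff h x))%E.

Definition KL_with h xbar eta phi :=
  [/\ (0 < eta)%E, desingularizing eta phi &
      exists2 U, nbhs xbar U & KL_inequality h xbar eta phi U].

Definition KL_property h xbar :=
  limiting_subdiff h xbar !=set0 /\ exists eta phi, KL_with h xbar eta phi.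

Definition KL_exponent (a : R) h xbar :=
  [/\ 0 <= a < 1, limiting_subdiff h xbar !=set0 &
      exists eta gamma, 0 < gamma /\
        KL_with h xbar eta (fun s => gamma * s `^ (1 - a))].

End KurdykaLojasiewicz.

(* The integer interval {a, a + 1, ..., b}, for a <= b. *)
Definition int_range (a b : int) : seq int :=
  [seq a + k%:Z | k <- iota 0 `|b - a|%N.+1].

Lemma mem_int_range (a b i : int) : a <= b ->
  (i \in int_range a b) = (a <= i <= b).
Proof.
move=> ab; apply/mapP/andP => [[k + ->]|[ai ib]].
  by rewrite mem_iota /= => kb; split; lia.
by exists `|i - a|%N; [rewrite mem_iota; lia | lia].
Qed.

(* Extension of a sequence to int by zero at negative indices. *)
Definition ext0 (R : realType) (u : nat -> R) (k : int) : R :=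
  if k is Posz n then u n else 0.

(* Extension to int of a sequence of points: the value at a negative index is
   a junk value, used only in statements about all sufficiently large indices. *)
Definition at_int (T : Type) (u : nat -> T) (k : int) : T := u `|k|%N.

Definition increment_bound (R : realType) (H : finHilbertType R)
    (x : nat -> H) (Delta : nat -> R) :=
  exists (j : int) (c : R),
    forall n : nat, `|x n.+1 - x n| <= c * ext0 Delta (n%:Z + j).

(* Main.v *)
(* Let s_n = h(z_n) - hbar, which decreases to 0 by (H1) and (H3), and let w_n be
   the weighted sum of the Delta_(n-i). The cluster points of the bounded sequence
   (z_n) can be handled by finitely many KL inequalities, so a single function phi
   works along the tail of (z_n). Concavity of phi with (H1), (H2) gives
     gamma * Delta_n^2 <= (phi(s_n) - phi(s_(n+1))) * (w_n + eps_n),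
   hence 2 Delta_n <= (phi(s_n) - phi(s_(n+1))) / gamma + w_n + eps_n. Since the
   lambda_i sum to 1, summing w_n only costs one copy of the sum of the Delta_n up
   to boundary terms, which are bounded because (Delta_n) is; this gives (i) and
   (ii). Then the right-hand side of (H2) tends to 0, and (iii) follows from the
   closedness of the graph of the limiting subdifferential.
   For (iv), an exponent at most 1/2 gives s_n <= C dist(0, subdiff h(z_n))^2, and
   (H1), (H2) bound the latter by a multiple of s_(n-i1) - s_(n+1-i0). As i0 <= 1,
   this is a contraction s_(k+m) <= q s_k with m = i1 + 1 - i0. Finally
   Delta_n^2 <= s_n / inf alpha decays geometrically, and so do the increments of
   (x_n). *)
Require Import Defs.
From HB Require Import structures.
From mathcomp Require Import all_boot all_order all_algebra.
From mathcomp Require Import zify ring lra.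
From mathcomp Require Import all_classical all_reals all_analysis.

Set Implicit Arguments.
Unset Strict Implicit.
Unset Printing Implicit Defensive.

Import Order.TTheory GRing.Theory Num.Theory.
Import numFieldNormedType.Exports.
Import VectorInternalTheory.

Local Open Scope classical_set_scope.
Local Open Scope ring_scope.

(** * Compactness of balls and cluster points of bounded sequences *)

Lemma r2v_continuous (R : realType) (V : finHilbertType R) :
  continuous (r2v : 'rV[R]_(dim V) -> V).
Proof.
have -> : (r2v : 'rV[R]_(dim V) -> V) = (fun u =>
    \sum_i u 0 i *: (r2v (delta_mx 0 i) : V)).
  apply/funext => u; rewrite {1}[u]row_sum_delta. rewrite linear_sum.
  by apply: eq_bigr => i _; rewrite linearZ.
apply: continuous_big => [|i _ u]; first exact: add_continuous.

by apply: (@cvgZr_tmp R V _ (nbhs u) _ (fun M => M 0 i)); exact: coord_continuous.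
Qed.

(* The coordinate isomorphism maps the compact unit sphere of ['rV_n] away from
   0, hence is bounded below, so its inverse maps bounded sets to bounded sets. *)
Lemma compact_norm_le (R : realType) (V : finHilbertType R) (M : R) :
  compact [set x : V | `|x| <= M].
Proof.
pose n := dim V; pose f : 'rV[R]_n -> V := r2v.
have fC : continuous f := @r2v_continuous R V.
have fK : cancel (v2r : V -> 'rV[R]_n) f.
  exact: v2rK.
have f0 u : f u = 0 -> u = 0.
  by move=> fu; apply: r2v_inj; rewrite [LHS]fu linear0.
pose S := [set u : 'rV[R]_n | `|u| = 1].
have Scl : closed S.
  rewrite (_ : S = (Num.norm : 'rV[R]_n -> R) @^-1` [set 1]) //.
  apply: preimage_closed (@closed_eq R _) => u _.
  exact: norm_continuous.
have Sb : bounded_set S.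
  exists 1; split; first exact: num_real.
  by move=> x x1 u /= ->; exact: ltW.
have Scp : compact (f @` S).
  apply: continuous_compact (bounded_closed_compact Sb Scl).
  exact: continuous_subspaceT.
have : \forall y \near (0 : V), ~ (f @` S) y.
  apply: (@open_nbhs_nbhs _ 0 (~` (f @` S))); split.
    by apply: closed_openC; apply: compact_closed Scp; exact: norm_hausdorff.
  move=> [u /= u1 /f0 u0]; have /eqP := oner_neq0 R; apply.
  by rewrite -u1 u0; exact: (@normr0 _ 'rV[R]_n).
move=> /nbhs_normP [e /= e0 eS].
have lef u : e * `|u| <= `|f u|.
  have [->|u0] := eqVneq u 0; first by rewrite /f linear0 !normr0 mulr0.
  have nu : 0 < `|u| by rewrite normr_gt0.
  rewrite leNgt; apply/negP => lt.
  apply: (eS (f (`|u|^-1 *: u))).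
    rewrite /ball_ /= sub0r normrN /f linearZ normrZ ger0_norm ?invr_ge0//.
    by rewrite mulrC ltr_pdivrMr.
  by exists (`|u|^-1 *: u) => //=; rewrite /S/= mx_normZ normfV normr_id mulVf// gt_eqF.
pose B := [set u : 'rV[R]_n | `|f u| <= M].
have Bcl : closed B.
  rewrite (_ : B = (fun u => `|f u|) @^-1` [set y | y <= M]) //.
  apply: preimage_closed (@closed_le R _) => u _.
  apply: (continuous_comp (fC u)); exact: norm_continuous.
have Bb : bounded_set B.
  exists (e^-1 * M); split; first exact: num_real.
  move=> x xM u /= uM; apply: le_trans (ltW xM).
  by rewrite ler_pdivlMl//; exact: le_trans (lef u) uM.
rewrite (_ : [set x | _] = f @` B).
  apply: continuous_compact (bounded_closed_compact Bb Bcl).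
  exact: continuous_subspaceT.
apply/seteqP; split=> [x /= xM|_ [u uM <-]//].
by exists (v2r x); rewrite /B/= fK.
Qed.

(** If [P K] failed, the sets whose relative complement in [K] satisfies [P] would form a proper
    filter containing [K]. By compactness it would have a cluster point in [K]; but the complement
    of a neighbourhood [U] of that point with [P U] belongs to the filter, a contradiction. *)
Lemma compact_ind (T : topologicalType) (P : set T -> Prop) (K : set T) :
    P set0 -> (forall A B, A `<=` B -> P B -> P A) ->
    (forall A B, P A -> P B -> P (A `|` B)) ->
    (forall p, K p -> exists2 U, nbhs p U & P U) ->
  compact K -> P K.
Proof.
move=> P0 PS PU Ploc cK; apply: contrapT => nPK.
pose F : set_system T := [set B | P (K `\` B)].
have FF : ProperFilter F.
  apply: Build_ProperFilter_ex.
    move=> B FB; apply: contrapT => /set0P/negP/negPn/eqP B0.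
    by apply: nPK; move: FB; rewrite /F/= B0 setD0.
  split=> [|A B FA FB|A B AB]; rewrite /F/=.
  - by rewrite setDT.
  - by rewrite setDIr; exact: PU.
  - by apply: PS => x [Kx nBx]; split=> // /AB.
have FK : F K by rewrite /F/= setDv.
have [p [Kp clp]] := cK F FF FK.
have [U Up PUU] := Ploc p Kp.
have FU : F (~` U) by apply: PS PUU => x [_ /contrapT].
by have [x []] := clp _ _ FU Up.
Qed.

(** Turns local statements at cluster points into statements about a whole tail: any other point has
    a neighbourhood that the sequence eventually avoids, and compactness of a ball containing all
    [z n] glues finitely many pieces. *)
Lemma cluster_ind (R : realType) (V : finHilbertType R) (z : nat -> V)
    (P : set V -> Prop) :
    bounded_fun z ->
    (forall A, (\forall n \near \oo, ~ A (z n)) -> P A) ->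
    (forall A B, A `<=` B -> P B -> P A) ->
    (forall A B, P A -> P B -> P (A `|` B)) ->
    (forall p, cluster (z @ \oo) p -> exists2 U, nbhs p U & P U) ->
  exists2 A, P A & forall n, A (z n).
Proof.
move=> /pinfty_ex_gt0 [M M0 zM] Pev PS PU Pcl.
exists [set x : V | `|x| <= M]; last by move=> n; exact: zM.
apply: compact_ind (@compact_norm_le _ V M) => //.
  by apply: Pev; apply: nearW => n [].
move=> p _; have [/Pcl//|/existsNP[A /existsNP[B]]] := pselect (cluster (z @ \oo) p).
move=> /not_implyP[zA /not_implyP[Bp nAB]].
exists B => //; apply: Pev; near=> n => Bzn; apply: nAB; exists (z n); split=> //.
by near: n; exact: zA.
Unshelve. all: by end_near. Qed.

(** Otherwise the induction, applied to the sets that the sequence eventually avoids, yields such a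
    set containing every [z n]. *)
Lemma bounded_cluster (R : realType) (V : finHilbertType R) (z : nat -> V) :
  bounded_fun z -> cluster (z @ \oo) !=set0.
Proof.
move=> bz; apply: contrapT => /set0P/negP/negPn/eqP c0.
have [||||A /filter_ex[n]] := @cluster_ind _ _ z
  (fun A => \forall n \near \oo, ~ A (z n)) bz; last exact.
- by [].
- by move=> A B AB; apply: filterS => n nB /AB.
- by move=> A B nA nB; near=> n => -[]; [near: n; exact: nA|near: n; exact: nB].
- by move=> p; rewrite c0.
Unshelve. all: by end_near. Qed.

(** * Nonnegative series and sequences of finite length *)

Lemma nneseries_ltyP (R : realType) (u : nat -> R) : (forall n, 0 <= u n) ->
  (\sum_(0 <= n <oo) (u n)%:E < +oo)%E <->
  exists C, forall m, \sum_(0 <= n < m) u n <= C.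
Proof.
move=> u0; split=> [uy|[C uC]].
  have s0 : (0 <= \sum_(0 <= n <oo) (u n)%:E)%E.
    by apply: nneseries_ge0 => n _ _; rewrite lee_fin.
  exists (fine (\sum_(0 <= n <oo) (u n)%:E)%E) => m.
  rewrite -lee_fin fineK ?ge0_fin_numE// -sumEFin.
  by apply: nneseries_lim_ge => n _ _; rewrite lee_fin.
apply: le_lt_trans (ltry C); apply: lime_le.
  by apply: is_cvg_nneseries => n _ _; rewrite lee_fin.
by apply: nearW => m; rewrite sumEFin lee_fin.
Qed.

Lemma nneseries_tail_lt (R : realType) (u : nat -> R) (e : R) :
    (forall n, 0 <= u n) -> (\sum_(0 <= n <oo) (u n)%:E < +oo)%E -> 0 < e ->
  exists N, (\sum_(N <= n <oo) (u n)%:E < e%:E)%E.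
Proof.
move=> u0 uy e0; have u0E k : true -> (0 <= (u k)%:E)%E by rewrite lee_fin.
have := nneseries_tail_cvg uy u0E.
move=> /fine_cvgP[fin /cvgr_lt /(_ _ e0) lt].
near \oo => N; exists N.
rewrite -[X in (X < _)%E]fineK; last by near: N; exact: fin.
by rewrite lte_fin; near: N; exact: lt.
Unshelve. all: by end_near. Qed.

Lemma norm_telescope_le (R : realType) (V : normedModType R) (x : nat -> V)
    (n m : nat) : (n <= m)%N ->
  `|x m - x n| <= \sum_(n <= k < m) `|x k.+1 - x k|.
Proof. by move=> nm; rewrite -telescope_sumr// ler_norm_sum. Qed.

(** Completeness comes from compactness of balls: the sequence is bounded, so it has a cluster
    point, and the small tails of the series force convergence to that point. *)
Lemma summable_increments_cvg (R : realType) (V : finHilbertType R)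
    (x : nat -> V) :
  (\sum_(0 <= n <oo) `|x n.+1 - x n|%:E < +oo)%E -> cvgn x.
Proof.
move=> xy; have [C xC] := (nneseries_ltyP (fun n => normr_ge0 (x n.+1 - x n))).1 xy.
have xb : bounded_fun x.
  exists (C + `|x 0%N|); split; first exact: num_real.
  move=> M /ltW CM n _ /=; apply: le_trans CM.
  rewrite -(subrK (x 0%N) (x n)) (le_trans (ler_normD _ _))// lerD2r.
  exact: le_trans (norm_telescope_le _ (leq0n n)) (xC n).
have [p px] := bounded_cluster xb.
apply/cvg_ex; exists p; apply/cvgrPdist_lt => e e0.
have e3 : 0 < e / 3 by rewrite divr_gt0.
have [N tN] : exists N, forall m, (N <= m)%N -> `|x m - x N| < e / 3.
  have [N sN] := nneseries_tail_lt (fun n => normr_ge0 (x n.+1 - x n)) xy e3.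
  exists N => m Nm.
  rewrite -lte_fin; apply: le_lt_trans sN.
  apply: le_trans (@nneseries_lim_ge _ _ xpredT N m _); last first.
    by move=> n _ _; rewrite lee_fin.
  by rewrite sumEFin lee_fin; exact: norm_telescope_le.
(* One late index [m] with [x m] close to [p] suffices; [x N] links it to every later [x n]. *)
have [_ [[m Nm <-] /= pm]] : [set x n | n in [set n | (N <= n)%N]] `&`
    [set y | `|p - y| < e / 3] !=set0.
  apply: px; first by exists N => // n /= Nn; exists n.
  by apply/nbhs_normP; exists (e / 3).
near=> n.
have Nn : (N <= n)%N by near: n; exact: nbhs_infty_ge.
rewrite (_ : p - x n = (p - x m) + (x m - x N) - (x n - x N)); last first.
  by rewrite opprB !addrA !subrK.
have := tN _ Nm; have := tN _ Nn.
have := ler_normB (p - x m + (x m - x N)) (x n - x N).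
have := ler_normD (p - x m) (x m - x N).
by move: pm; lra.
Unshelve. all: by end_near. Qed.

(** * Closedness of the graph of the limiting subdifferential *)

Lemma cvg_harmonic_close (R : realType) (V : normedModType R) (a b : nat -> V)
    (l : V) : a n @[n --> \oo] --> l ->
  (forall n, `|a n - b n| <= n.+1%:R^-1) -> b n @[n --> \oo] --> l.
Proof.
move=> al ab; apply/cvgrPdist_lt => e e0.
have e2 : 0 < e / 2 by rewrite divr_gt0.
near=> n.
have an : `|l - a n| < e / 2 by near: n; exact: cvgr_dist_lt.
have nn : n.+1%:R^-1 < e / 2 by near: n; exact: near_infty_natSinv_lt (PosNum e2).
rewrite (_ : l - b n = (l - a n) + (a n - b n)); last by rewrite addrA subrK.
apply: le_lt_trans (ler_normD _ _) _.
by rewrite (splitr e) ltrD// (le_lt_trans (ab n)).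
Unshelve. all: by end_near. Qed.

(** Diagonal argument: each limiting pair is replaced by a Frechet pair within [1 / (n + 1)] of it
    in point, subgradient and function value, which leaves the three limits unchanged. *)
Lemma limiting_subdiff_closed (R : realType) (K : finHilbertType R)
    (h : K -> \bar R) (x u : K) (y_ u_ : nat -> K) :
    h x \is a fin_num ->
    y_ n @[n --> \oo] --> x -> h (y_ n) @[n --> \oo] --> h x ->
    (forall n, limiting_subdiff h (y_ n) (u_ n)) -> u_ n @[n --> \oo] --> u ->
  limiting_subdiff h x u.
Proof.
move=> hx yx hyx yu uu; split=> //.
have /choice[f fP] n : exists p : K * K,
    [/\ frechet_subdiff h p.1 p.2, `|y_ n - p.1| <= n.+1%:R^-1,
        `|u_ n - p.2| <= n.+1%:R^-1 &
        `|fine (h (y_ n)) - fine (h p.1)| <= n.+1%:R^-1].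
  have [hyn [y' [u' [y'y hy' fr u'u]]]] := yu n.
  have n0 : 0 < n.+1%:R^-1 :> R by rewrite invr_gt0.
  have hy'r : fine (h (y' k)) @[k --> \oo] --> fine (h (y_ n)).
    by apply: fine_cvg; rewrite fineK.
  have : \forall k \near \oo, [/\ `|y_ n - y' k| <= n.+1%:R^-1,
      `|u_ n - u' k| <= n.+1%:R^-1 &
      `|fine (h (y_ n)) - fine (h (y' k))| <= n.+1%:R^-1].
    near=> k; split.
    - by near: k; exact: cvgr_dist_le.
    - by near: k; exact: cvgr_dist_le.
    - by near: k; exact: cvgr_dist_le.
  by move=> /filter_ex[k [? ? ?]]; exists (y' k, u' k); split=> //; exact: fr.
exists (fun n => (f n).1), (fun n => (f n).2); split.
- by apply: cvg_harmonic_close yx _ => n; have [] := fP n.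
- rewrite -(fineK hx).
  rewrite (_ : (fun n => h _) = (fun n => (fine (h (f n).1))%:E)); last first.
    by apply/funext => n; rewrite fineK//; have [[]] := fP n.
  apply: cvg_EFin; first exact: nearW.
  apply: (@cvg_harmonic_close _ R^o (fun n => fine (h (y_ n)))).
    by apply: fine_cvg; rewrite fineK.
  by move=> n; have [] := fP n.
- by move=> n; have [] := fP n.
- by apply: cvg_harmonic_close uu _ => n; have [] := fP n.
Unshelve. all: by end_near. Qed.

(** * Slopes of desingularizing functions *)

(** By concavity the left difference quotients at [s] are at most the slope of the chord from [t] to
    [s]; let the increment tend to 0. Only the derivative at [s] enters, so [t] may be 0. *)
Lemma desingularizing_slope (R : realType) (eta : \bar R) (phi : R -> R)
    (s t : R) : desingularizing eta phi ->
    0 <= t <= s -> 0 < s -> (s%:E < eta)%E ->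
  derive1 phi s * (s - t) <= phi s - phi t.
Proof.
move=> [[_ _ _ cvx] der _ _] /andP[t0 ts] s0 seta.
have [->|t_neq_s] := eqVneq t s; first by rewrite !subrr mulr0.
have {t_neq_s}ts : 0 < s - t by rewrite subr_gt0 lt_neqAle t_neq_s.
have teta : (t%:E < eta)%E by apply: le_lt_trans seta; rewrite lee_fin; lra.
rewrite -ler_pdivlMr// derive1E.
have /der/cvg_dnbhs_at_left ds : open_itv eta s by [].
apply: (cvgr_to_le ds); near=> u.
have u0 : u < 0 by near: u; exact: nbhs_left_lt.
have us : - (s - t) <= u by near: u; apply: nbhs_left_ge; rewrite oppr_lt0.
(* The weight for which [l * t + (1 - l) * s] equals [u + s]. *)
pose l := - u / (s - t).
have l0 : 0 <= l by rewrite divr_ge0 ?oppr_ge0 ?ltW.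
have l1 : l <= 1 by rewrite ler_pdivrMr// mul1r lerNl.
have H : - phi (l * t + (1 - l) * s) <= l * - phi t + (1 - l) * - phi s.
  by apply: (cvx (Itv01 l0 l1) t s); rewrite inE; split=> //; exact: ltW.
have ul : u = - (l * (s - t)) by rewrite /l divfK ?gt_eqF// opprK.
have {}H : 0 <= (s - t) * (phi (u + s) - phi s + l * (phi s - phi t)).
  apply: mulr_ge0; [exact: ltW|move: H].
  by rewrite (_ : l * t + (1 - l) * s = u + s); [lra|rewrite ul; ring].
rewrite /GRing.scale/= mulr1 ler_pdivlMr// -(ler_nM2l u0) !mulrA mulfV ?lt_eqF//.
by rewrite mul1r [X in X * _ <= _](_ : _ = - (l * (s - t))) //; move: H; lra.
Unshelve. all: by end_near. Qed.

(** * Index shifts and finite length *)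

Lemma sum_ext0_shift (R : realType) (u : nat -> R) (j : int) (m : nat) :
    (forall n, 0 <= u n) ->
  \sum_(0 <= n < m) ext0 u (n%:Z + j) <= \sum_(0 <= n < m + `|j|) u n.
Proof.
move=> u0.
have mono a b : (a <= b)%N -> \sum_(0 <= n < a) u n <= \sum_(0 <= n < b) u n.
  by move=> ab; rewrite (big_cat_nat (leq0n a) ab)/= lerDl sumr_ge0.
case: (intP j) => [|k|k].
- by rewrite addn0 le_eqVlt; apply/orP; left; apply/eqP/eq_bigr => n _; rewrite addr0.
- elim: m => [|m IH]; first by rewrite big_geq// sumr_ge0.
  rewrite big_nat_recr//= addSn big_nat_recr//=; exact: lerD.
- suff : \sum_(0 <= n < m) ext0 u (n%:Z - k.+1%:Z) <= \sum_(0 <= n < m - k.+1) u n.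
    by move/le_trans; apply; apply: mono; lia.
  elim: m => [|m IH]; first by rewrite !big_geq.
  rewrite big_nat_recr//=; have [km|mk] := leqP k.+1 m.
    rewrite subSn// big_nat_recr//= lerD//.
    by rewrite (_ : m%:Z - k.+1%:Z = (m - k.+1)%N) //; lia.
  have -> : (m.+1 - k.+1 = m - k.+1)%N by lia.
  have -> : m%:Z - k.+1%:Z = Negz (k - m)%N by lia.
  by rewrite /= addr0.
Qed.

(** The sum of [u] keeps the coefficient 1, so that it can later be absorbed; the shift costs at
    most as many extra terms as the absolute value of [j], each at most [D]. *)
Lemma sum_ext0_shift_bounded (R : realType) (u : nat -> R) (D : R) (j : int)
    (m : nat) :
    (forall n, 0 <= u n <= D) ->
  \sum_(0 <= n < m) ext0 u (n%:Z + j)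
    <= \sum_(0 <= n < m) u n + `|j|%N%:R * D.
Proof.
move=> uD; apply: (le_trans (sum_ext0_shift _ _ _)) => [n|].
  by have /andP[] := uD n.
rewrite (big_cat_nat (leq0n m) (leq_addr _ m))/= lerD2l.
apply: (@le_trans _ _ (\sum_(m <= n < m + `|j|) D)).
  by apply: ler_sum => n _; have /andP[] := uD n.
by rewrite sumr_const_nat addKn mulr_natl.
Qed.

(** Summing the step inequality telescopes [p]. As the weights sum to 1, the averages sum to at most
    the sum of [Delta] plus the constant [L], and one of the two copies of that sum on the left
    absorbs them. *)
Lemma finite_length (R : realType) (r : seq int) (lambda : int -> R)
    (Delta eps p : nat -> R) (D E : R) (N : nat) :
    (forall i, i \in r -> 0 <= lambda i) -> \sum_(i <- r) lambda i = 1 ->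
    (forall n, 0 <= Delta n <= D) ->
    (forall m, \sum_(0 <= n < m) eps n <= E) ->
    (forall n, (N <= n)%N -> 0 <= p n) ->
    (forall n, (N <= n)%N -> 2 * Delta n <= p n - p n.+1 +
      (\sum_(i <- r) lambda i * ext0 Delta (n%:Z - i) + eps n)) ->
    (forall n, 0 <= eps n) ->
  exists C, forall m, \sum_(0 <= n < m) Delta n <= C.
Proof.
move=> l0 l1 DD epsE p0 step eps0; pose T m := \sum_(0 <= n < m) Delta n.
have D0 n : 0 <= Delta n by have /andP[] := DD n.
pose w n := \sum_(i <- r) lambda i * ext0 Delta (n%:Z - i).
pose L := \sum_(i <- r) lambda i * (`|i|%N%:R * D).
have w0 n : 0 <= w n.
  rewrite /w big_seq sumr_ge0// => i ir; rewrite mulr_ge0 ?l0//.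
  by case: (n%:Z - i).
have wT m : \sum_(0 <= n < m) w n <= T m + L.
  rewrite exchange_big/= -[T m]mul1r -l1 mulr_suml -big_split/=.
  rewrite big_seq [leRHS]big_seq; apply: ler_sum => i ir.
  rewrite -mulr_sumr -mulrDr ler_wpM2l ?l0//.
  by have := @sum_ext0_shift_bounded _ _ D (- i) m DD; rewrite abszN.
(* The right-hand sums may start at 0 instead of [N] because their terms are nonnegative; they then
   match [wT] and [epsE]. *)
have key k : 2 * T (N + k)%N + p (N + k)%N <= 2 * T N + p N +
    (\sum_(0 <= n < N + k) w n + \sum_(0 <= n < N + k) eps n).
  elim: k => [|k IH]; first by rewrite addn0 lerDl addr_ge0// sumr_ge0.
  rewrite addnS /T !big_nat_recr//= -!/(T _).
  by have := step _ (leq_addr k N); rewrite -/(w _); move: IH; lra.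
exists (2 * T N + p N + L + E) => m; apply: (@le_trans _ _ (T (N + m)%N)).
  by rewrite [leRHS](@big_cat_nat _ _ _ m)//= ?leq_addl// lerDl sumr_ge0.
have := key m; have := wT (N + m)%N; have := epsE (N + m)%N.
by have := p0 _ (leq_addr m N); lra.
Qed.

(* The KL inequality at [s], multiplied by the slope of [phi] and combined with
   the descent and error conditions gives [gam * D ^+ 2 <= (phi s - phi s') * w];
   conclude by AM-GM. *)
Lemma KL_step (R : realType) (D w d s s' a b gam phis phis' psi : R) :
    0 <= D -> 0 < b -> 0 < gam -> gam <= a * b -> a * D ^+ 2 <= s - s' ->
    psi * (s - s') <= phis - phis' -> 0 < psi -> 1 <= psi * d -> b * d <= w ->
  2 * D <= (phis - phis') / gam + w.
Proof.
move=> D0 b0 gam0 gab aD slope psi0 KL dw.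
have d0 : 0 < d by rewrite -(pmulr_rgt0 _ psi0) (lt_le_trans _ KL).
have w0 : 0 < w by rewrite (lt_le_trans _ dw)// mulr_gt0.
have a0 : 0 < a by rewrite -(pmulr_lgt0 _ b0) (lt_le_trans gam0).
have ss' : 0 <= s - s' by rewrite (le_trans _ aD)// mulr_ge0 ?sqr_ge0// ltW.
have phi0 : 0 <= phis - phis' := le_trans (mulr_ge0 (ltW psi0) ss') slope.
pose F := (phis - phis') / gam.
have F0 : 0 <= F by exact: divr_ge0 phi0 (ltW gam0).
have Fg : F * gam = phis - phis' by rewrite divfK// gt_eqF.
have DFw : D ^+ 2 <= F * w.
  rewrite -(ler_pM2l gam0) (mulrA gam F) [gam * F]mulrC Fg.
  apply: (@le_trans _ _ ((s - s') * b)).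
    apply: (@le_trans _ _ (a * b * D ^+ 2)); first by rewrite ler_wpM2r ?sqr_ge0.
    by rewrite mulrAC ler_wpM2r// ltW.
  apply: (@le_trans _ _ ((phis - phis') * (b * d))); last first.
    by rewrite ler_wpM2l.
  apply: (@le_trans _ _ ((s - s') * b * (psi * d))).
    by rewrite ler_peMr//; exact: mulr_ge0 ss' (ltW b0).
  rewrite (_ : _ * _ = psi * (s - s') * (b * d)); last by ring.
  by rewrite ler_wpM2r// ltW// mulr_gt0.
rewrite -/F -(@ler_pXn2r _ 2)// ?nnegrE ?mulr_ge0 ?addr_ge0 ?(ltW w0)//.
rewrite exprMn; have : 0 <= (F - w) ^+ 2 by exact: sqr_ge0.
by move: DFw; nra.
Qed.

(** * Geometric decay from a delayed contraction *)

(** Strong induction in steps of length [m], with [rho] the root of [q] of order [m]. *)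
Lemma geometric_decay (R : realType) (s : nat -> R) (q : R) (m N : nat) :
    (forall n, 0 <= s n) -> (forall n, s n.+1 <= s n) -> 0 < q < 1 ->
    (0 < m)%N -> (forall n, (N <= n)%N -> s (n + m)%N <= q * s n) ->
  exists c rho, [/\ 0 < c, 0 < rho < 1 & forall n, s n <= c * rho ^+ n].
Proof.
move=> s0 sdec /andP[q0 q1] m0 sq; pose rho := q `^ m%:R^-1.
have mR0 : m%:R != 0 :> R by rewrite pnatr_eq0 -lt0n.
have rhom : rho ^+ m = q.
  by rewrite -powR_mulrn ?powR_ge0// -powRrM mulVf// powRr1// ltW.
have rho0 : 0 < rho by exact: powR_gt0.
have rho1 : rho < 1.
  rewrite ltNge; apply/negP => /(exprn_ege1 m); rewrite rhom => q1'.
  by move: q1; rewrite ltNge q1'.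
(* For [n < N + m], [rho ^+ n] is at least [rho ^+ (N + m)], so this constant covers [s 0], which
   bounds [s n]; the added 1 makes it positive. *)
pose c := (s 0%N + 1) / rho ^+ (N + m).
have c0 : 0 < c by rewrite divr_gt0 ?exprn_gt0// ltr_wpDl.
have s0n n : s n <= s 0%N by elim: n => // n; exact: le_trans.
exists c, rho; rewrite rho0 rho1; split=> // n.
elim/ltn_ind: n => n IH; have [nNm|Nmn] := ltnP n (N + m)%N.
  rewrite (le_trans (s0n n))// /c mulrAC ler_pdivlMr ?exprn_gt0//.
  apply: (@le_trans _ _ (s 0%N * rho ^+ n)).
    by apply: ler_wpM2l => //; apply: ler_wiXn2l; [exact: ltW|exact: ltW|exact: ltnW].
  by rewrite ler_wpM2r ?exprn_ge0 ?(ltW rho0)// lerDl.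
have mn : (m <= n)%N by lia.
rewrite -(subnK mn); apply: (le_trans (sq _ _)); first by lia.
rewrite exprD rhom mulrA [leRHS]mulrC ler_pM2l//; apply: IH; lia.
Qed.

(** * Null sequences, subsequences and monotone limits *)

Lemma bounded_sums_cvg0 (R : realType) (u : nat -> R) (C : R) :
    (forall n, 0 <= u n) -> (forall m, \sum_(0 <= n < m) u n <= C) ->
  u n @[n --> \oo] --> 0.
Proof.
move=> u0 uC; apply: cvg_series_cvg_0; apply: nondecreasing_is_cvgn.
  by apply: nondecreasing_series => n _ _; exact: u0.
by exists C => _ [m _ <-]; exact: uC.
Qed.

Lemma ext0_cvg0 (R : realType) (u : nat -> R) (j : int) :
  u n @[n --> \oo] --> 0 -> ext0 u (n%:Z + j) @[n --> \oo] --> 0.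
Proof.
move=> u0; apply/cvgrPdist_lt => e e0.
have [N _ uN] : \forall n \near \oo, `|0 - u n| < e by exact: cvgr_dist_lt.
near=> n; have : (`|j| + N <= n)%N by near: n; exact: nbhs_infty_ge.
move=> jNn; have -> : n%:Z + j = (absz (n%:Z + j))%:Z by lia.
by apply: uN => /=; lia.
Unshelve. all: by end_near. Qed.

Lemma increasing_seq_id_le (k : nat -> nat) (n : nat) :
  increasing_seq k -> (n <= k n)%N.
Proof.
move=> /increasing_seqP kS; elim: n => // n IH.
exact: leq_ltn_trans IH (kS n).
Qed.

Lemma cvg_subseq_cluster (R : realType) (V : normedModType R) (z : nat -> V)
    (k : nat -> nat) (p : V) :
    increasing_seq k -> z (k n) @[n --> \oo] --> p -> cluster (z @ \oo) p.
Proof.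
move=> kinc zkp A B [N _ zA] Bp.
have /filter_ex[n [Nn Bzn]] : \forall n \near \oo, (N <= n)%N /\ B (z (k n)).
  by near=> n; split; near: n; [exact: nbhs_infty_ge|exact: zkp].
exists (z (k n)); split=> //; apply: zA => /=.
exact: leq_trans Nn (increasing_seq_id_le n kinc).
Unshelve. all: by end_near. Qed.

(** The selection [f] need not be increasing: [n <= f n] already makes it tend to infinity, which is
    enough to pass to limits. The predicate lets the required precision depend on [n]. *)
Lemma cluster_subseq (R : realType) (V : normedModType R) (z : nat -> V) (p : V)
    (P : nat -> nat -> Prop) :
    cluster (z @ \oo) p -> (forall n, \forall m \near \oo, P n m) ->
  exists f : nat -> nat,
    [/\ forall n, P n (f n), f n @[n --> \oo] --> \oo &
        z (f n) @[n --> \oo] --> p].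
Proof.
move=> clp evP.
have /choice[f fP] n : exists m,
    [/\ P n m, (n <= m)%N & `|p - z m| <= n.+1%:R^-1].
  have [N _ NP] := evP n.
  have [_ [[m [Nm nm] <-] /= pm]] :
      [set z m | m in [set m | (N <= m)%N /\ (n <= m)%N]] `&`
      [set y | `|p - y| < n.+1%:R^-1] !=set0.
    apply: clp.
      by exists (maxn N n) => // m /=; rewrite geq_max => /andP[? ?]; exists m.
    by apply/nbhs_normP; exists n.+1%:R^-1 => //=; rewrite invr_gt0.
  by exists m; split=> //; [exact: NP|exact: ltW].
exists f; split=> [n||]; first by have [] := fP n.
  apply/cvgnyPge => A; near=> n; have [_ nf _] := fP n.
  by apply: leq_trans nf; near: n; exact: nbhs_infty_ge.
apply: (@cvg_harmonic_close _ _ (fun=> p)); first exact: cvg_cst.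
by move=> n; have [] := fP n.
Unshelve. all: by end_near. Qed.

Lemma nonincreasing_subseq_cvg (R : realType) (s : nat -> R) (k : nat -> nat)
    (l : R) :
    (forall n, s n.+1 <= s n) -> increasing_seq k ->
    s (k n) @[n --> \oo] --> l ->
  (forall n, l <= s n) /\ s n @[n --> \oo] --> l.
Proof.
move=> sS kinc skl.
have /nonincreasing_seqP sdec := sS.
have ls n : l <= s n.
  apply: (cvgr_to_le skl); near=> m; apply: sdec.
  apply: leq_trans (increasing_seq_id_le m kinc).
  by near: m; exact: nbhs_infty_ge.
split=> //; apply/cvgrPdist_lt => e e0.
have /filter_ex[m skm] : \forall m \near \oo, `|l - s (k m)| < e.
  exact: cvgr_dist_lt.
near=> n; have /sdec nm : (k m <= n)%N by near: n; exact: nbhs_infty_ge.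
move: skm; rewrite !(distrC l) !ger0_norm ?subr_ge0//.
by apply: le_lt_trans; rewrite lerD2r.
Unshelve. all: by end_near. Qed.

(** * KL inequalities along the sequence *)

Lemma dist0_ge0 (R : realType) (K : finHilbertType R) (A : set K) :
  (0 <= dist0 A)%E.
Proof. by apply: le_ereal_inf_tmp => _ [u _ <-]; rewrite lee_fin. Qed.

Section KL_along_sequence.
Variables (R : realType) (K : finHilbertType R) (h : K -> \bar R).
Variables (z : nat -> K) (hb : R).
Let s n := fine (h (z n)) - hb.
Let d n := fine (dist0 (limiting_subdiff h (z n))).
Hypothesis hz_fin : forall n, h (z n) \is a fin_num.
Hypothesis d_fin : forall n, dist0 (limiting_subdiff h (z n)) \is a fin_num.
Hypothesis s_ge0 : forall n, 0 <= s n.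
Hypothesis s_cvg : s n @[n --> \oo] --> 0.
Hypothesis z_bounded : bounded_fun z.
Hypothesis h_cluster : forall p, cluster (z @ \oo) p -> h p = hb%:E.

Let d_ge0 n : 0 <= d n.
Proof. exact/fine_ge0/dist0_ge0. Qed.

(** As [s] tends to 0, the upper restriction on values in the KL inequality eventually holds by
    itself, and the lower one becomes [0 < s n]. *)
Lemma KL_with_near p eta phi : h p = hb%:E -> KL_with h p eta phi ->
  exists2 U, nbhs p U & \forall n \near \oo, ((s n)%:E < eta)%E /\
    (U (z n) -> 0 < s n -> 1 <= derive1 phi (s n) * d n).
Proof.
move=> hp [eta0 _ [U Up KL]]; exists U => //; near=> n.
have seta : ((s n)%:E < eta)%E.
  near: n; case: eta eta0 {KL} => [eta||]//= eta0.
    move: eta0; rewrite lte_fin => eta0.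
    by apply: filterS (cvgr_lt _ s_cvg _ eta0) => m; rewrite lte_fin.
  by apply: nearW => m; exact: ltry.
split=> // Uz s0; have sE : (h (z n) - h p)%E = (s n)%:E.
  by rewrite hp -(fineK (hz_fin n)) EFinB.
have hE : h (z n) = (hb + s n)%:E by rewrite /s addrC subrK fineK.
have := KL _ Uz; rewrite sE hE hp !lte_fin ltrDl => /(_ s0).
have -> : (hb%:E + eta = eta + hb%:E)%E by rewrite addeC.
rewrite EFinD addeC lte_leD// => /(_ isT).
by rewrite -(fineK (d_fin n)) -EFinM lee_fin.
Unshelve. all: by end_near. Qed.

(* Finitely many desingularizing functions are replaced by their sum; besides
   nonnegativity, the descent argument uses only its slope inequality. *)
Lemma uniform_KL :
    (forall p, cluster (z @ \oo) p -> KL_property h p) ->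
  exists phi psi : R -> R, \forall n \near \oo, 0 <= phi (s n) /\
    (0 < s n -> [/\ 0 < psi (s n), 1 <= psi (s n) * d n &
      forall t, 0 <= t <= s n -> psi (s n) * (s n - t) <= phi (s n) - phi t]).
Proof.
(* Only the KL inequality is restricted to [z n] in [A]. Positivity and slope bounds hold on a whole
   tail, so adding the functions of two sets preserves the KL inequality of each. [psi] stands for
   the derivative of [phi]. *)
move=> KL; pose P (A : set K) := exists phi psi : R -> R, \forall n \near \oo,
  0 <= phi (s n) /\ (0 < s n -> [/\ 0 < psi (s n),
    A (z n) -> 1 <= psi (s n) * d n &
    forall t, 0 <= t <= s n -> psi (s n) * (s n - t) <= phi (s n) - phi t]).
have [|A B AB [phi [psi PB]]|A B [f1 [g1 PA]] [f2 [g2 PB]]|p clp|A] :=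
    @cluster_ind _ _ z P z_bounded.
(* On a set avoided by the tail the KL inequality is void, and the identity with slope 1 meets the
   other requirements. *)
- move=> A nA; exists id, (fun=> 1); near=> n; split=> // sn0; split=> //.
    by move=> An; exfalso; move: An; near: n.
  by move=> t _; rewrite mul1r.
- exists phi, psi; apply: filterS PB => n [phi0 H]; split=> // /H[? dn ?].
  by split=> // /AB.
- exists (fun x => f1 x + f2 x), (fun x => g1 x + g2 x).
  near=> n; have [f10 H1] : 0 <= f1 (s n) /\ (0 < s n -> [/\ 0 < g1 (s n),
    A (z n) -> 1 <= g1 (s n) * d n &
    forall t, 0 <= t <= s n -> g1 (s n) * (s n - t) <= f1 (s n) - f1 t]).
    by near: n.
  have [f20 H2] : 0 <= f2 (s n) /\ (0 < s n -> [/\ 0 < g2 (s n),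
    B (z n) -> 1 <= g2 (s n) * d n &
    forall t, 0 <= t <= s n -> g2 (s n) * (s n - t) <= f2 (s n) - f2 t]).
    by near: n.
  split; first exact: addr_ge0.
  move=> sn; have [g10 A1 sl1] := H1 sn; have [g20 B2 sl2] := H2 sn.
  split; first exact: addr_gt0.
    rewrite mulrDl => -[/A1 le1|/B2 le1].
      by rewrite (le_trans le1)// lerDl mulr_ge0// ltW.
    by rewrite (le_trans le1)// lerDr mulr_ge0// ltW.
  by move=> t tn; have := sl1 _ tn; have := sl2 _ tn; lra.
- have [_ [eta [phi KLp]]] := KL p clp.
  have [_ des _] := KLp.
  have [U Up Un] := KL_with_near (h_cluster clp) KLp.
  exists U => //; exists phi, (derive1 phi).
  apply: filterS Un => n [seta dn]; split.
    by have [[_ + _ _] _ _ _] := des; apply.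
  move=> sn; split.
  + by have [_ _ _] := des; apply.
  + by move=> Uz; exact: dn.
  + by move=> t tn; exact: (desingularizing_slope des).
- move=> [phi [psi H]] Az; exists phi, psi; apply: filterS H => n [? H].
  by split=> // /H[? /(_ (Az n)) ? ?].
Unshelve. all: by end_near. Qed.

(* For [phi s = gam * s `^ (1 - a)], the slope inequality at 0 gives
   [phi' s * s <= phi s <= gam * sqrt s] when [s <= 1]. *)
Lemma uniform_KL_exponent (a : R) : a <= 2^-1 ->
    (forall p, cluster (z @ \oo) p -> KL_exponent a h p) ->
  exists2 C, 0 < C & \forall n \near \oo, s n <= C * d n ^+ 2.
Proof.
move=> a2 KL; pose P (A : set K) := exists2 C, 0 < C &
  \forall n \near \oo, A (z n) -> s n <= C * d n ^+ 2.
have [|A B AB [C C0 PB]|A B [C1 C10 PA] [C2 C20 PB]|p clp|A] :=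
    @cluster_ind _ _ z P z_bounded.
- move=> A nA; exists 1 => //; near=> n => An; exfalso; move: An; near: n.
  exact: nA.
- by exists C => //; apply: filterS PB => n H /AB.
- exists (C1 + C2); first exact: addr_gt0.
  near=> n; rewrite mulrDl => -[] zn.
    have /le_trans : s n <= C1 * d n ^+ 2 by move: zn; near: n; exact: PA.
    by apply; rewrite lerDl mulr_ge0 ?sqr_ge0// ltW.
  have /le_trans : s n <= C2 * d n ^+ 2 by move: zn; near: n; exact: PB.
  by apply; rewrite lerDr mulr_ge0 ?sqr_ge0// ltW.
- have [_ _ [eta [gam [gam0 KLp]]]] := KL p clp.
  have [eta0 des _] := KLp.
  have [U Up Un] := KL_with_near (h_cluster clp) KLp.
  exists U => //; exists (gam ^+ 2); first exact: exprn_gt0.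
  near=> n => Uzn.
  have s1 : s n < 1 by near: n; exact: (cvgr_lt _ s_cvg _ ltr01).
  have [seta dn] : ((s n)%:E < eta)%E /\ (U (z n) -> 0 < s n ->
    1 <= derive1 (fun s => gam * s `^ (1 - a)) (s n) * d n) by near: n.
  have := s_ge0 n; rewrite le_eqVlt => /orP[/eqP<-|sn].
    by rewrite mulr_ge0 ?sqr_ge0.
  have {}dn := dn Uzn sn.
  have := @desingularizing_slope _ _ _ (s n) 0 des.
  rewrite lexx (s_ge0 n) => /(_ isT sn seta).
  (* A power of 0 vanishes only for a nonzero exponent; here [1 - a] is at least 1/2. *)
  rewrite powR0 ?mulr0 ?subr0; last by apply/eqP; lra.
  move=> slope; have pow : s n `^ (1 - a) <= Num.sqrt (s n).
    by rewrite -powR12_sqrt ?s_ge0// ger_powR ?sn ?(ltW s1)//; lra.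
  have sq0 : 0 < Num.sqrt (s n) by rewrite sqrtr_gt0.
  (* Multiply the KL inequality by [s n] and apply the slope bound; dividing by the square root of
     [s n] and squaring then gives the claim. *)
  have key : s n <= gam * Num.sqrt (s n) * d n.
    apply: (@le_trans _ _ (gam * s n `^ (1 - a) * d n)); last first.
      by rewrite ler_wpM2r// ler_wpM2l// ltW.
    apply: le_trans (ler_wpM2r (d_ge0 n) slope).
    by rewrite mulrAC ler_peMl.
  have : Num.sqrt (s n) <= gam * d n.
    rewrite -(ler_pM2l sq0) -expr2 sqr_sqrtr ?s_ge0//.
    by apply: le_trans key _; rewrite mulrAC [leRHS]mulrC.
  move=> H; rewrite -exprMn -[leLHS]sqr_sqrtr ?s_ge0//.
  by rewrite ler_pXn2r// nnegrE ?(ltW sq0)// mulr_ge0// ltW.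
- move=> [C C0 H] Az; exists C => //; apply: filterS H => n; exact.
Unshelve. all: by end_near. Qed.

End KL_along_sequence.

(** * Contraction of the value gap and geometric rates *)

Lemma weighted_sum_le (R : realType) (I : eqType) (r : seq I)
    (lambda F : I -> R) (M : R) :
    (forall i, i \in r -> 0 <= lambda i) -> \sum_(i <- r) lambda i = 1 ->
    (forall i, i \in r -> F i <= M) ->
  \sum_(i <- r) lambda i * F i <= M.
Proof.
move=> l0 l1 FM; rewrite -[leRHS]mul1r -l1 mulr_suml big_seq [leRHS]big_seq.
by apply: ler_sum => i ir; rewrite ler_wpM2l ?l0 ?FM.
Qed.

(** With [n = k + i1] and [m = i1 + 1 - i0], the hypothesis bounds [s n] by [C * (s k - s (k + m))].
    Since [i0 <= 1] gives [n <= k + m], monotonicity yields [(1 + C) * s (k + m) <= C * s k]. *)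
Lemma gap_decay (R : realType) (s : nat -> R) (i0 i1 : int) (C : R) (N : nat) :
    (forall n, 0 <= s n) -> (forall n, s n.+1 <= s n) -> 0 < C ->
    i0 <= i1 -> i0 <= 1 ->
    (forall n, (N <= n)%N -> 0 <= n%:Z - i1 ->
      s n <= C * (at_int s (n%:Z - i1) - at_int s (n%:Z + 1 - i0))) ->
  exists c rho, [/\ 0 < c, 0 < rho < 1 & forall n, s n <= c * rho ^+ n].
Proof.
move=> s0 sS C0 i01 i0_le1 gap; have /nonincreasing_seqP sdec := sS.
have C1 : 0 < 1 + C by rewrite addr_gt0.
have q01 : 0 < C / (1 + C) < 1.
  by rewrite divr_gt0//= ltr_pdivrMr// mul1r ltrDr.
pose m := absz (i1 + 1 - i0)%R.
have m0 : (0 < m)%N by rewrite /m; lia.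
apply: (geometric_decay s0 sS q01 m0 (N := (N + absz i1)%N)).
move=> k Nk; pose n := absz (k%:Z + i1)%R.
have Nn : (N <= n)%N by rewrite /n; lia.
have kE : n%:Z - i1 = k by rewrite /n; lia.
have kmE : n%:Z + 1 - i0 = (k + m)%N by rewrite /n /m; lia.
have := gap n Nn; rewrite kE kmE /at_int !absz_nat => /(_ isT).
have : s (k + m)%N <= s n by apply: sdec; rewrite /n /m; lia.
move=> sn /(le_trans sn) {}sn.
by rewrite mulrAC ler_pdivlMr//; move: sn; lra.
Qed.

Lemma geometric_increments (R : realType) (V : normedModType R) (x : nat -> V)
    (xbar : V) (C r : R) :
    0 <= C -> 0 < r < 1 -> (forall n, `|x n.+1 - x n| <= C * r ^+ n) ->
    x n @[n --> \oo] --> xbar ->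
  forall n, `|x n - xbar| <= C / (1 - r) * r ^+ n.
Proof.
move=> C0 /andP[r0 r1] xr xx n; have r1' : 0 < 1 - r by rewrite subr_gt0.
(* Keeping the exact partial geometric sum, with its subtracted power, makes the induction close. *)
have dist p : `|x n - x (n + p)%N| <= C / (1 - r) * (r ^+ n - r ^+ (n + p)).
  elim: p => [|p IH]; first by rewrite addn0 !subrr normr0 mulr0.
  rewrite addnS -(subrKA (x (n + p)%N)); apply: (le_trans (ler_normD _ _)).
  have := xr (n + p)%N; rewrite distrC => /(lerD IH)/le_trans; apply.
  rewrite le_eqVlt; apply/orP; left; apply/eqP; rewrite exprS; field.
  by rewrite gt_eqF.
have cv : `|x n - x m| @[m --> \oo] --> `|x n - xbar|.
  by apply: cvg_norm; apply: cvgB => //; exact: cvg_cst.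
apply: (cvgr_to_le cv); near=> m.
have nm : (n <= m)%N by near: m; exact: nbhs_infty_ge.
rewrite -(subnKC nm); apply: (le_trans (dist _)).
by rewrite ler_wpM2l ?divr_ge0 ?(ltW r1')// gerBl exprn_ge0// ltW.
Unshelve. all: by end_near. Qed.

Lemma at_int_subE (R : realType) (K : Type) (h : K -> \bar R) (z : nat -> K)
    (l : R) (k k' : int) : (forall n, h (z n) \is a fin_num) ->
  fine (h (at_int z k) - h (at_int z k'))%E =
    at_int (fun n => fine (h (z n)) - l) k -
    at_int (fun n => fine (h (z n)) - l) k'.
Proof.
by move=> hz; rewrite /at_int fineB// opprB addrA subrK.
Qed.

(** For [i0 <= i <= i1] the interval from [n - i] to [n - i + 1] lies between [n - i1] and
    [n + 1 - i0], so [S] dominates each descent step and [Delta] at [n - i] is at most [b] times the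
    root of [S / del]. The weighted average inherits this bound, and [b] cancels. *)
Lemma subdiff_gap (R : realType) (r : seq int) (lambda : int -> R)
    (s Delta alpha : nat -> R) (i0 i1 : int) (n : nat) (b d del eps M : R)
    (S := at_int s (n%:Z - i1) - at_int s (n%:Z + 1 - i0)) :
    (forall i, i \in r -> 0 <= lambda i) -> \sum_(i <- r) lambda i = 1 ->
    (forall i, i \in r -> i0 <= i <= i1) -> i0 <= i1 -> 0 <= n%:Z - i1 ->
    (forall n, s n.+1 <= s n) -> (forall n, 0 <= Delta n) ->
    (forall n, alpha n * Delta n ^+ 2 <= s n - s n.+1) -> 0 < b -> 0 < del ->
    (forall i, i \in r -> 0 <= n%:Z - i ->
      del <= alpha `|n%:Z - i|%N * b ^+ 2) ->
    b * d <= \sum_(i <- r) lambda i * ext0 Delta (n%:Z - i) + eps ->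
    eps / b <= M * Num.sqrt S ->
  d <= (Num.sqrt del^-1 + M) * Num.sqrt S.
Proof.
move=> l0 l1 rI i01 ni1 sS D0 aDs b0 del0 del_le dE epsS.
have /nonincreasing_seqP sdec := sS.
have S0 : 0 <= S by rewrite subr_ge0; apply: sdec; clear -i01 ni1; lia.
have wS : \sum_(i <- r) lambda i * ext0 Delta (n%:Z - i) <= b * Num.sqrt (S / del).
  apply: weighted_sum_le => // i ir; have /andP[i0i ii1] := rI i ir.
  have ni : 0 <= n%:Z - i by clear -ii1 ni1; lia.
  have del_m := del_le i ir ni; rewrite -(gez0_abs ni) /=.
  set m := absz _ in del_m *.
  rewrite -(@ler_pXn2r _ 2)// ?nnegrE ?mulr_ge0 ?sqrtr_ge0 ?(ltW b0)//.
  rewrite exprMn sqr_sqrtr ?divr_ge0 ?(ltW del0)// mulrA ler_pdivlMr//.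
  apply: (@le_trans _ _ (Delta m ^+ 2 * (alpha m * b ^+ 2))).
    by rewrite ler_wpM2l ?sqr_ge0.
  rewrite mulrA [leRHS]mulrC ler_wpM2r ?sqr_ge0// mulrC.
  apply: le_trans (aDs m) _; rewrite /S /at_int.
  by apply: lerB; apply: sdec; rewrite /m; clear -ni i0i ii1 ni1; lia.
have eS : eps <= b * (M * Num.sqrt S) by rewrite mulrC -ler_pdivrMr.
rewrite -(ler_pM2l b0); apply: le_trans dE _; apply: le_trans (lerD wS eS) _.
by rewrite [S / del]mulrC sqrtrM ?invr_ge0 ?(ltW del0)// -mulrDr -mulrDl.
Qed.

(** A shift by [j] changes the exponent by at most the absolute value of [j]; at negative indices
    the left side is 0. *)
Lemma ext0_geometric (R : realType) (u : nat -> R) (G q : R) (j : int) (n : nat) :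
    0 <= G -> 0 < q < 1 -> (forall n, u n <= G * q ^+ n) ->
  ext0 u (n%:Z + j) <= G / q ^+ `|j|%N * q ^+ n.
Proof.
move=> G0 /andP[q0 q1] uG.
have qX0 m : 0 <= q ^+ m by rewrite exprn_ge0// ltW.
rewrite mulrAC ler_pdivlMr ?exprn_gt0//.
case E : (n%:Z + j) => [p|p] /=; last by rewrite mul0r mulr_ge0.
apply: le_trans (ler_wpM2r (qX0 _) (uG p)) _.
rewrite -mulrA -exprD; apply: ler_wpM2l => //.
by apply: ler_wiXn2l; [exact: ltW|exact: ltW|lia].
Qed.

Lemma inf_range_le (R : realType) (u : nat -> R) (n : nat) :
  (forall n, 0 < u n) -> inf [set u n | n in [set: nat]] <= u n.
Proof.
move=> u0; apply: ge_inf; last by exists n.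
by exists 0 => _ [m _ <-]; exact: ltW.
Qed.

Theorem theorem5p2 (R : realType) (H K : finHilbertType R) (h : K -> \bar R)
    (x : nat -> H) (z : nat -> K) (alpha beta Delta eps : nat -> R)
    (i0 i1 : int) (lambda : int -> R)
    (h_proper : proper_function h) (h_lsc : lower_semicontinuous h)
    (alpha_gt0 : forall n, 0 < alpha n) (beta_gt0 : forall n, 0 < beta n)
    (Delta_ge0 : forall n, 0 <= Delta n) (eps_ge0 : forall n, 0 <= eps n)
    (le_i0_i1 : i0 <= i1)
    (lambda_ge0 : forall i, i0 <= i <= i1 -> 0 <= lambda i)
    (lambda_sum : \sum_(i <- int_range i0 i1) lambda i = 1)
    (H1 : forall n, (h (z n.+1) + (alpha n * Delta n ^+ 2)%:E <= h (z n))%E)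
    (H2 : forall n,
      ((beta n)%:E * dist0 (limiting_subdiff h (z n)) <=
       (\sum_(i <- int_range i0 i1) lambda i * ext0 Delta (n%:Z - i)
        + eps n)%:E)%E)
    (H3 : exists (k : nat -> nat) (zt : K),
      [/\ increasing_seq k, z (k n) @[n --> \oo] --> zt &
          h (z (k n)) @[n --> \oo] --> h zt])
    (H4 : [/\ 0 < inf [set alpha n | n in [set: nat]],
              0 < inf [set alpha n * beta n | n in [set: nat]] &
              (\sum_(1 <= n <oo) (eps n)%:E < +oo)%E])
    (z_bounded : bounded_fun z)
    (Omega := cluster (z @ \oo))
    (h_const : forall u v, Omega u -> Omega v -> h u = h v)
    (h_KL : forall u, Omega u -> KL_property h u)
    (Omega0 := [set zb | Omega zb /\ h (z n) @[n --> \oo] --> h zb])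
    (hbar : \bar R) (hbarE : forall u, Omega0 u -> h u = hbar) :
  [/\ (* (i) *)
      (\sum_(0 <= n <oo) (Delta n)%:E < +oo)%E,
      (* (ii) *)
      increment_bound x Delta ->
        (\sum_(0 <= n <oo) `|x n.+1 - x n|%:E < +oo)%E /\ cvgn x,
      (* (iii) *)
      0 < inf [set beta n | n in [set: nat]] ->
        forall zb, Omega0 zb -> limiting_subdiff h zb 0 &
      (* (iv) *)
      forall a : R, a <= 2^-1 -> (forall u, Omega u -> KL_exponent a h u) ->
        i0 <= 1 ->
        0 < inf [set r | exists (n : nat) (i : int),
                   [/\ i0 <= i <= i1, 0 <= n%:Z - i &
                       r = alpha `|n%:Z - i|%N * beta n ^+ 2]] ->
        (fun n => eps n / beta n) =O_\oo
          (fun n => Num.sqrt (fine (h (at_int z (n%:Z - i1))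
                                    - h (at_int z (n%:Z + 1 - i0)))%E)) ->
        exists gamma1 rho : R,
          [/\ 0 < gamma1, 0 < rho < 1,
              forall n, (h (z n) - hbar <= (gamma1 * rho ^+ n)%:E)%E &
              increment_bound x Delta ->
              (fun n => fine (\sum_(n <= k <oo) (eps k)%:E)%E) =O_\oo
                (fun n => Num.sqrt (fine (h (at_int z (n%:Z - i1)) - hbar)%E)) ->
              exists (xbar : H) (gamma2 : R),
                0 < gamma2 /\
                forall n, `|x n - xbar| <= gamma2 * rho `^ (n%:R / 2)]].
Proof.

(* Finiteness of the values and their common limit *)
pose r := int_range i0 i1.
have lam0 i : i \in r -> 0 <= lambda i by rewrite mem_int_range//; exact: lambda_ge0.
pose d n := fine (dist0 (limiting_subdiff h (z n))).
pose w n := \sum_(i <- r) lambda i * ext0 Delta (n%:Z - i).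
have d_fin n : dist0 (limiting_subdiff h (z n)) \is a fin_num.
  rewrite ge0_fin_numE ?dist0_ge0//; have := H2 n.
  case: (dist0 _) => [q _||]; [exact: ltry|by rewrite gt0_muley ?lte_fin|by []].
have dE n : beta n * d n <= w n + eps n.
  by rewrite -lee_fin EFinM fineK.
(* A finite distance means that the subdifferential is nonempty, and subgradients exist only where
   [h] is finite. *)
have h_fin n : h (z n) \is a fin_num.
  have : (dist0 (limiting_subdiff h (z n)) < +oo)%E.
    by rewrite -ge0_fin_numE// dist0_ge0.
  by move=> /ereal_inf_lt[_ [u [hz _] _] _].
pose hv n := fine (h (z n)).
have hvE n : h (z n) = (hv n)%:E by rewrite fineK.
have H1r n : alpha n * Delta n ^+ 2 <= hv n - hv n.+1.
  by have := H1 n; rewrite !hvE -EFinD lee_fin; lra.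
have aD0 n : 0 <= alpha n * Delta n ^+ 2 by rewrite mulr_ge0 ?sqr_ge0// ltW.
have hvS n : hv n.+1 <= hv n by have := H1r n; have := aD0 n; lra.
have [k [zt [kinc zk hk]]] := H3.
have zt_fin : h zt \is a fin_num.
  rewrite fin_numElt (h_proper.1 zt)/=; apply: le_lt_trans (ltry (hv 0%N)).
  rewrite -(cvg_lim (@ereal_hausdorff _) hk); apply: lime_le; first exact: cvgP hk.
  apply: nearW => n; rewrite hvE lee_fin.
  by have /nonincreasing_seqP := hvS; apply.
pose l := fine (h zt).
have [hvl hv_cvg] : (forall n, l <= hv n) /\ hv n @[n --> \oo] --> l.
  by apply: (nonincreasing_subseq_cvg hvS kinc); apply: fine_cvg; rewrite fineK.
have h_cvg : h (z n) @[n --> \oo] --> l%:E.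
  rewrite (_ : (fun n => h (z n)) = EFin \o hv); last exact/funext.
  by apply: cvg_EFin => //; exact: nearW.
have zt_Omega : Omega zt := cvg_subseq_cluster kinc zk.
have Omega_l p : Omega p -> h p = l%:E.
  by move=> Op; rewrite (h_const _ _ Op zt_Omega) fineK.
(* [zt] itself lies in [Omega0], so [hbar] is its value. *)
have hbar_l : hbar = l%:E.
  by rewrite -(hbarE zt) ?fineK//; split=> //; rewrite -(fineK zt_fin).
pose s n := fine (h (z n)) - l.
have s0 n : 0 <= s n by rewrite /s subr_ge0; exact: hvl.
have sS n : s n.+1 <= s n by rewrite /s lerD2r; exact: hvS.
have s_cvg : s n @[n --> \oo] --> 0.
  by rewrite -(subrr l); apply: cvgB => //; exact: cvg_cst.
have sdec n m : (n <= m)%N -> s m <= s n.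
  by have /nonincreasing_seqP := sS; apply.
have aDs n : alpha n * Delta n ^+ 2 <= s n - s n.+1.
  by rewrite /s opprB addrA subrK; exact: H1r.

(* Summability of [Delta] and of the increments of [x] *)
have [a0 gam0 eps_sum] := H4.
set al := inf _ in a0; set gam := inf _ in gam0.
have al_le n : al <= alpha n by exact: inf_range_le.
have gam_le n : gam <= alpha n * beta n.
  by apply: (@inf_range_le _ (fun n => alpha n * beta n)) => m; exact: mulr_gt0.
have Dsq n : Delta n ^+ 2 <= s n / al.
  rewrite ler_pdivlMr// mulrC; apply: (@le_trans _ _ (s n - s n.+1)).
    by apply: le_trans (aDs n); rewrite ler_wpM2r ?sqr_ge0.
  by rewrite gerBl.
(* Nonnegativity of [(Delta n - 1) ^+ 2] bounds [Delta n] by [1 + Delta n ^+ 2]. *)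
have D_bnd n : 0 <= Delta n <= 1 + s 0%N / al.
  rewrite Delta_ge0/=; have : s n / al <= s 0%N / al.
    by rewrite ler_pM2r ?invr_gt0//; exact: sdec.
  by have := Dsq n; have := sqr_ge0 (Delta n - 1); nra.
have [E eps_bnd] : exists E, forall m, \sum_(0 <= n < m) eps n <= E.
  have eps_fin : (\sum_(1 <= n <oo) (eps n)%:E)%E \is a fin_num.
    by rewrite ge0_fin_numE// nneseries_ge0// => n _ _; rewrite lee_fin.
  (* The series in [H4] starts at index 1, hence the separate term [eps 0]. *)
  exists (eps 0%N + fine (\sum_(1 <= n <oo) (eps n)%:E)%E) => -[|m].
    by rewrite big_geq// addr_ge0// fine_ge0// nneseries_ge0// => n _ _; rewrite lee_fin.
  rewrite big_ltn// lerD2l -lee_fin fineK// -sumEFin.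
  by apply: nneseries_lim_ge => n _ _; rewrite lee_fin.
have w0 n : 0 <= w n.
  rewrite /w big_seq sumr_ge0// => i ir; rewrite mulr_ge0 ?lam0//.
  by case: (n%:Z - i).
have [C D_sum] : exists C, forall m, \sum_(0 <= n < m) Delta n <= C.
  have [phi [psi [N _ KLn]]] :=
    uniform_KL h_fin d_fin s0 s_cvg z_bounded Omega_l h_KL.
  apply: (@finite_length _ r lambda Delta eps (fun n => phi (s n) / gam)
    _ E N lam0 lambda_sum D_bnd eps_bnd) => // n Nn.
    by have [phi0 _] := KLn n Nn; rewrite divr_ge0// ltW.
  (* When the gap [s n] is already 0 the KL inequality says nothing, but then the descent condition
     forces [Delta n = 0]. *)
  rewrite -mulrBl -/(w n); have := s0 n; rewrite le_eqVlt => /orP[/eqP sn|sn].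
    have sn1 : s n.+1 = s n by apply/eqP; rewrite eq_le sS -sn s0.
    have D2 : Delta n ^+ 2 <= 0 by have := Dsq n; rewrite -sn mul0r.
    have -> : Delta n = 0 by apply/eqP; rewrite -sqrf_eq0 eq_le D2 sqr_ge0.
    by rewrite sn1 subrr mul0r mulr0 add0r addr_ge0.
  have [_ /(_ sn)[psi0 KL1 slope]] := KLn n Nn.
  apply: (KL_step _ (beta_gt0 n) gam0 (gam_le n) (aDs n) (slope _ _) psi0 KL1 (dE n)) => //.
  by rewrite s0 sS.
(* The constant may be negative; as [Delta] is nonnegative, its absolute value serves as well. *)
have incr_bnd : increment_bound x Delta -> exists j c, 0 <= c /\
    forall n, `|x n.+1 - x n| <= c * ext0 Delta (n%:Z + j).
  move=> [j [c xc]]; exists j, `|c|; split=> // n.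
  apply: le_trans (xc n) _; rewrite ler_wpM2r ?ler_norm//.
  by case: (n%:Z + j).
have ii : increment_bound x Delta ->
    (\sum_(0 <= n <oo) `|x n.+1 - x n|%:E < +oo)%E.
  move=> /incr_bnd[j [c [c0 xc]]].
  apply/(nneseries_ltyP (fun n => normr_ge0 (x n.+1 - x n))).
  exists (c * C) => m; apply: (@le_trans _ _
    (\sum_(0 <= n < m) c * ext0 Delta (n%:Z + j))); first exact: ler_sum.
  rewrite -mulr_sumr ler_wpM2l//.
  exact: le_trans (sum_ext0_shift _ _ Delta_ge0) (D_sum _).
split.
- exact/nneseries_ltyP/ex_intro.
- by move=> xD; split; [exact: ii|exact: summable_increments_cvg (ii xD)].

(* Criticality of cluster points *)
- move=> beta_inf zb [zbO hzb]; set bb := inf _ in beta_inf.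
  have bb_le n : bb <= beta n by exact: inf_range_le.
  (* [d n] is at most [(w n + eps n) / bb], where [w] averages finitely many shifts of the null
     sequence [Delta] and [eps] is summable. *)
  have d_cvg : d n @[n --> \oo] --> 0.
    have we_cvg : (w n + eps n) / bb @[n --> \oo] --> 0.
      rewrite -(mul0r bb^-1); apply: cvgM; last exact: cvg_cst.
      rewrite -(addr0 0); apply: cvgD; last exact: bounded_sums_cvg0 eps_bnd.
      rewrite [X in _ --> X](_ : 0 = \sum_(i <- r) lambda i * 0); last first.
        by rewrite big1// => i _; rewrite mulr0.
      apply: cvg_big => [|i _]; first exact: add_continuous.
      apply: cvgM; [exact: cvg_cst|apply: ext0_cvg0].
      exact: bounded_sums_cvg0 D_sum.
    apply: (squeeze_cvgr _ (cvg_cst 0) we_cvg); apply: nearW => n.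
    rewrite fine_ge0 ?dist0_ge0//= ler_pdivlMr// mulrC; apply: le_trans (dE n).
    by rewrite ler_wpM2r// fine_ge0 ?dist0_ge0.
  have n0 n : 0 < n.+1%:R^-1 :> R by rewrite invr_gt0.
  (* Along this selection there are subgradients of norm at most [1 / (n + 1)], so closedness of the
     graph yields 0 in the limit. *)
  have [f [fd foo zf]] := cluster_subseq (P := fun n m => d m < n.+1%:R^-1)
    zbO (fun n => cvgr_lt _ d_cvg _ (n0 n)).
  have /choice[u uP] n : exists u, limiting_subdiff h (z (f n)) u /\
      `|0 - u| <= n.+1%:R^-1.
    have : (dist0 (limiting_subdiff h (z (f n))) < n.+1%:R^-1%:E)%E.
      by rewrite -(fineK (d_fin _)) lte_fin; exact: fd.
    move=> /ereal_inf_lt[_ [u hu <-]]; rewrite lte_fin => un.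
    by exists u; split=> //; rewrite sub0r normrN ltW.
  apply: (@limiting_subdiff_closed _ _ h zb 0 (z \o f) u).
  + by rewrite (Omega_l _ zbO).
  + exact: zf.
  + by apply: cvg_comp foo hzb.
  + by move=> n; have [] := uP n.
  + apply: (@cvg_harmonic_close _ _ (fun=> 0)); first exact: cvg_cst.
    by move=> n; have [] := uP n.

(* Linear rates under a KL exponent *)
- move=> a a2 KLa i0_le1 del0 /eqO_exP[M M0 epsO].
  set dset := [set _ | _] in del0; set del := inf _ in del0.
  have del_le n (i : int) : i \in r -> 0 <= n%:Z - i ->
      del <= alpha `|n%:Z - i|%N * beta n ^+ 2.
    move=> ir ni; apply: ge_inf.
      by exists 0 => _ [m [j [_ _ ->]]]; rewrite mulr_ge0 ?sqr_ge0// ltW.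
    by exists n, i; split=> //; rewrite -mem_int_range.
  have [A A0 sA] := uniform_KL_exponent h_fin d_fin s0 s_cvg z_bounded Omega_l a2 KLa.
  pose B := Num.sqrt del^-1 + M.
  have B0 : 0 < B by rewrite addr_gt0 ?sqrtr_gt0 ?invr_gt0.
  (* Combines [s n <= A * d n ^+ 2] with the bound of [d n] by [B] times the root of the gap
     difference. *)
  have [N _ gap] : \forall n \near \oo, 0 <= n%:Z - i1 ->
      s n <= A * B ^+ 2 *
        (at_int s (n%:Z - i1) - at_int s (n%:Z + 1 - i0)).
    near=> n => ni1; set S := _ - _.
    have S0 : 0 <= S.
      rewrite subr_ge0; apply: sdec; clear -le_i0_i1 ni1; lia.
    have dS : d n <= B * Num.sqrt S.
      apply: (subdiff_gap lam0 lambda_sum _ le_i0_i1 ni1 sS Delta_ge0 aDs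
        (beta_gt0 n) del0 (del_le n) (dE n)) => [i|]; first by rewrite mem_int_range.
      have : `|eps n / beta n| <= M * `|Num.sqrt
        (fine (h (at_int z (n%:Z - i1)) - h (at_int z (n%:Z + 1 - i0)))%E)|.
        by near: n.
      rewrite (at_int_subE l _ _ h_fin) -/s -/S !ger0_norm ?sqrtr_ge0//.
      by rewrite divr_ge0// ltW.
    apply: (@le_trans _ _ (A * d n ^+ 2)); first by near: n; exact: sA.
    rewrite -mulrA ler_pM2l// -[S in leRHS]sqr_sqrtr// -exprMn.
    by rewrite ler_pXn2r// ?nnegrE ?fine_ge0 ?dist0_ge0 ?mulr_ge0 ?sqrtr_ge0 ?(ltW B0).
  have [g1 [rho [g10 rho01 rate]]] : exists c rho,
      [/\ 0 < c, 0 < rho < 1 & forall n, s n <= c * rho ^+ n].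
    apply: gap_decay s0 sS _ le_i0_i1 i0_le1 gap.
    by rewrite mulr_gt0// exprn_gt0.
  exists g1, rho; split=> //.
    by move=> n; rewrite hbar_l hvE -EFinB lee_fin; exact: rate.
  move=> xD _; have /cvg_ex[xbar xx] := summable_increments_cvg (ii xD).
  have [j [c [c0 xc]]] := incr_bnd xD.
  have /andP[rho0 rho1] := rho01.
  (* The value gap controls the square of [Delta n], so [Delta] and the increments decay at the rate
     of the root of [rho]. *)
  pose q := Num.sqrt rho.
  have q0 : 0 < q by rewrite sqrtr_gt0.
  have q1 : q < 1 by rewrite -(sqrtr1 R) ltr_sqrt.
  have qE n : rho ^+ n = (q ^+ n) ^+ 2 by rewrite -exprM mulnC exprM sqr_sqrtr// ltW.
  pose G := Num.sqrt (g1 / al).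
  have G0 : 0 < G by rewrite sqrtr_gt0 divr_gt0.
  have DG n : Delta n <= G * q ^+ n.
    rewrite -(@ler_pXn2r _ 2)// ?nnegrE ?mulr_ge0 ?(ltW G0) ?exprn_ge0 ?(ltW q0)//.
    rewrite exprMn sqr_sqrtr ?divr_ge0 ?(ltW g10) ?(ltW a0)// -qE; apply: le_trans (Dsq n) _.
    by rewrite mulrAC ler_pM2r ?invr_gt0.
  have xq n : `|x n.+1 - x n| <= c * G / q ^+ `|j|%N * q ^+ n.
    apply: le_trans (xc n) _; rewrite -!mulrA ler_wpM2l// mulrA.
    by apply: ext0_geometric => //; [exact: ltW|rewrite q0].
  (* The added 1 gives a positive constant even when [c] is 0. *)
  have g20 : 0 < c * G / q ^+ `|j|%N / (1 - q) + 1.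
    by rewrite ltr_wpDl// !mulr_ge0 ?invr_ge0 ?exprn_ge0 ?subr_ge0 ?(ltW q0) ?(ltW q1) ?(ltW G0).
  exists xbar, (c * G / q ^+ `|j|%N / (1 - q) + 1); split=> // n.
  have -> : rho `^ (n%:R / 2) = q ^+ n.
    by rewrite mulrC powRrM powR12_sqrt ?(ltW rho0)// powR_mulrn// ltW.
  have cG0 : 0 <= c * G / q ^+ `|j|%N.
    by rewrite !mulr_ge0 ?invr_ge0 ?exprn_ge0 ?(ltW q0) ?(ltW G0).
  have q01 : 0 < q < 1 by rewrite q0.
  apply: le_trans (geometric_increments cG0 q01 xq xx n) _.
  by rewrite ler_wpM2r ?exprn_ge0 ?(ltW q0)// lerDl.
Unshelve. all: by end_near. Qed.
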